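(* Let $q\ge 1$ be an integer and let $H$ be a generalized star graph with $k$ leaves. Then $Z_q(H)=k-1$.
   Context: Graphs are finite, simple and undirected. A generalized star graph (spider graph) is a graph consisting of a central vertex $c$ (the center) together with a nonempty collection of disjoint (nonempty) paths, possibly of different lengths, each of which is attached to the center at one of its endpoints (i.e. one endpoint of each path is joined by an edge to $c$, and there are no other edges between different paths or to $c$). A leaf is a vertex of degree one. The $q$-analogue of zero forcing ($Z_q$ game), for a fixed integer $q\ge 0$, is a game between a player and an oracle on a graph $G$. Initially all vertices are unfilled. The player repeatedly uses the following rules. Rule 1: fill any vertex at the cost of one token. Rule 2 (forcing rule): at no cost, a filled vertex with a unique unfilled neighbor forces that neighbor to be filled. Rule 3: let $F$ be the set of filled vertices and let $U_1,\dots,U_k$ be the connected components of $G[V\setminus F]$; if $k>q$, the player selects at least $q+1$ of the components $U_i$; the oracle then chooses a nonempty subset $\{U_{i_1},\dots,U_{i_l}\}$ of the selected components; the player may then, at no cost, apply the forcing rule in the subgraph of $G$ induced by $F\cup U_{i_1}\cup\dots\cup U_{i_l}$. The number $Z_q(G)$ is the minimum number of tokens with which the player can guarantee to fill all vertices of $G$, against an oracle trying to maximize the number of tokens spent. *)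

(* Defs.v *)
From mathcomp Require Import all_boot.
From mathcomp Require Import boolp.

Set Implicit Arguments.
Unset Strict Implicit.
Unset Printing Implicit Defensive.

(* A finite simple graph is an edge relation [e] on a finType [T] that is
   symmetric and irreflexive; these two properties are hypotheses of the
   theorems rather than part of the data. *)

Definition is_leaf (T : finType) (e : rel T) (x : T) : bool :=
  #|[set y | e x y]| == 1.

(* The sequence [c :: p] lists the vertices of the leg [p] outwards from the
   center, so its consecutive pairs are the edge joining [c] to [p] and the
   edges of [p] itself. *)
Definition generalized_star (T : finType) (e : rel T) : Prop :=
  exists (c : T) (legs : seq (seq T)),
    [/\ legs != [::],
        all (fun p => p != [::]) legs,
        uniq (c :: flatten legs),
        forall x, x \in c :: flatten legs
      & forall x y, e x y =
          has (fun p => infix [:: x; y] (c :: p) || infix [:: y; x] (c :: p))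
              legs].

Definition induced (T : finType) (e : rel T) (W : {set T}) : rel T :=
  [rel x y | [&& x \in W, y \in W & e x y]].

Definition components (T : finType) (e : rel T) (W : {set T}) :
    {set {set T}} :=
  equivalence_partition (connect (induced e W)) W.

(* In the subgraph induced by [W], the filled vertex [u] has [v] as its only
   unfilled neighbor; [F] is the set of filled vertices. *)
Definition forces (T : finType) (e : rel T) (W F : {set T}) (u v : T) : bool :=
  (u \in F :&: W) && ([set w in W :\: F | induced e W u w] == [set v]).

(* [force_seq e W F F']: finitely many (possibly zero) applications of the
   forcing rule in the subgraph induced by the fixed set [W] lead from [F]
   to [F']. *)
Inductive force_seq (T : finType) (e : rel T) (W : {set T}) :
    {set T} -> {set T} -> Prop :=
| force_seq_nil F : force_seq e W F F
| force_seq_cons F u v F' :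
    forces e W F u v -> force_seq e W (v |: F) F' -> force_seq e W F F'.

(* [player_wins q e n F]: starting from the filled set [F], the player has a
   strategy that fills every vertex in finitely many moves, spending at most
   [n] further tokens whatever the oracle does.
   In the third rule the player announces the set [S] of components, the
   oracle answers with a nonempty [O \subset S], and [resp O] is the filled
   set that the player then reaches by forcing. *)
Inductive player_wins (q : nat) (T : finType) (e : rel T) :
    nat -> {set T} -> Prop :=
| wins_done n : player_wins q e n [set: T]
| wins_fill n F v : player_wins q e n (v |: F) -> player_wins q e n.+1 F
| wins_force n F u v :
    forces e [set: T] F u v -> player_wins q e n (v |: F) ->
    player_wins q e n F
| wins_oracle n F (S : {set {set T}}) (resp : {set {set T}} -> {set T}) :
    S \subset components e (~: F) ->
    q < #|S| ->
    (forall O : {set {set T}}, O \subset S -> O != set0 ->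
       force_seq e (F :|: cover O) F (resp O)) ->
    (forall O : {set {set T}}, O \subset S -> O != set0 ->
       player_wins q e n (resp O)) ->
    player_wins q e n F.

Lemma player_wins_exists (q : nat) (T : finType) (e : rel T) :
  exists n, `[< player_wins q e n set0 >].
Proof.
suff H n (F : {set T}) : #|~: F| <= n -> player_wins q e n F.
  by exists #|~: (set0 : {set T})|; apply/asboolP; exact: H.
elim: n F => [|n IHn] F.
  rewrite leqn0 cards_eq0 => /eqP F0.
  by rewrite -[F]setCK F0 setC0; exact: wins_done.
have [->|] := eqVneq F setT; first by move=> _; exact: wins_done.
rewrite -subTset => /subsetPn[v _ vF] leF.
apply: (@wins_fill _ _ _ _ _ v); apply: IHn.
by move: leF; rewrite (cardsD1 v (~: F)) inE vF setCU setIC -setDE.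
Qed.

Definition Zq (q : nat) (T : finType) (e : rel T) : nat :=
  ex_minn (player_wins_exists q e).

(* Main.v *)
Require Import Defs.
From mathcomp Require Import all_boot.
From mathcomp Require Import boolp.

Set Implicit Arguments.
Unset Strict Implicit.
Unset Printing Implicit Defensive.

(** A spider with [m] legs has [m] leaves, except that the center of a spider
    with a single leg (a path) is a leaf as well; so [k - 1] is [m - 1] when
    [2 <= m], and [1] when [m = 1].

    Upper bound ([wins_spider]): for [2 <= m], the player pays for the tip of
    every leg but one and forces inwards along each of these legs, then into
    the center, then outwards along the last leg.  For [m = 1] one token on
    the center and outward forcing suffice.

    Lower bound: call a neighbor of the center untouched while its whole leg
    is unfilled ([untouched]).  A token touches at most one leg
    ([untouched_fill]).  The only force that reaches an untouched leg starts
    at the center, and it requires exactly one untouched leg to be visible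
    ([forces_untouched]), so the ordinary forcing rule can touch a leg only
    when that leg is the last one.  When the player selects at least two
    components, which is where [1 <= q] enters, the oracle can arrange that
    the number of visible untouched heads is not one ([oracle_answer]): if
    the selection shows exactly one, it withholds the component containing
    it.  Hence the oracle rule touches no leg, and the player pays for all
    legs but one.  For [m = 1] this bound is void, but the first
    move has to cost a token, as nothing can be forced from the empty set
    ([wins_no_token]). *)

(** * The oracle at a vertex whose neighbors lie in different branches *)

Section CutVertex.

(* [f] names the branch at [c] of each vertex other than [c]: branches are
   unions of components of the graph without [c], and each contains at most
   one neighbor of [c]. *)
Context (T : finType) (e : rel T) (c : T) (I : eqType) (f : T -> I).
Hypothesis e_sym : symmetric e.
Hypothesis e_irr : irreflexive e.
Hypothesis branch_adj :
  forall x y, e x y -> x != c -> y != c -> f x = f y.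
Hypothesis branch_inj :
  forall h h', e c h -> e c h' -> f h = f h' -> h = h'.

Definition untouched (F : {set T}) : {set T} :=
  [set h | e c h & [forall x in F, (x == c) || (f x != f h)]].

Lemma untouchedP (F : {set T}) h :
  reflect (e c h /\ forall x, x \in F -> x != c -> f x != f h)
          (h \in untouched F).
Proof.
rewrite inE; apply: (iffP andP) => -[ch Fh]; split=> //.
  move=> x xF xc; have /orP[/eqP xc'|//] := forall_inP Fh x xF.
  by rewrite xc' eqxx in xc.
by apply/forall_inP => x xF; case: eqVneq => //= xc; apply: Fh.
Qed.

Lemma untouched_unfilled F h : h \in untouched F -> h \notin F.
Proof.
move=> /untouchedP[ch Fh]; apply/negP => hF.
have hc : h != c by apply: contraTneq ch => ->; rewrite e_irr.
by have := Fh h hF hc; rewrite eqxx.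
Qed.

Lemma untouched_setU1_sub v F : untouched (v |: F) \subset untouched F.
Proof.
apply/subsetP => h /untouchedP[ch Fh]; apply/untouchedP; split=> // x xF.
by apply: Fh; rewrite inE xF orbT.
Qed.

(** The new vertex lies in only one branch, and [c] has at most one neighbor
    there. *)
Lemma untouched_fill v F : #|untouched F| <= #|untouched (v |: F)|.+1.
Proof.
have keep h : h \in untouched F -> (v == c) || (f v != f h) ->
    h \in untouched (v |: F).
  move=> /untouchedP[ch Fh] vh; apply/untouchedP; split=> // x.
  by rewrite !inE => /orP[/eqP -> vc|]; [rewrite (negPf vc) in vh | apply: Fh].
have [h /andP[hF fh]|none] := pickP [pred h in untouched F | f v == f h].
  apply: leq_trans (_ : #|h |: untouched (v |: F)| <= _); last first.
    by rewrite cardsU1; case: (_ \notin _).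
  apply/subset_leq_card/subsetP => h' h'F; rewrite inE in_set1.
  have [//|ne] := eqVneq h' h; apply: keep => //; apply/orP; right.
  rewrite (eqP fh); apply: contra ne => /eqP fhh.
  have /untouchedP[ch _] := hF; have /untouchedP[ch' _] := h'F.
  by apply/eqP; apply: branch_inj.
apply: leqW; apply/subset_leq_card/subsetP => h hF; apply: keep => //.
by have /= := none h; rewrite hF /= => ->; rewrite orbT.
Qed.

(** An untouched branch can only be entered from [c], through the neighbor [h]
    of [c] in it; then [h] is the unique unfilled neighbor of [c] in [W],
    and since untouched vertices are unfilled neighbors of [c], it is the only
    one in [W]. *)
Lemma forces_untouched W F u v :
  forces e W F u v -> #|untouched F :&: W| != 1 ->
  untouched (v |: F) = untouched F.
Proof.
move=> /andP[]; rewrite inE => /andP[uF uW] /eqP def_v not1.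
apply/eqP; rewrite eqEsubset untouched_setU1_sub /=; apply/subsetP => h hF.
have /untouchedP[ch Fh] := hF; apply/untouchedP; split=> // x.
rewrite !inE => /orP[/eqP -> vc|]; last exact: Fh.
have : v \in [set w in W :\: F | induced e W u w] by rewrite def_v set11.
rewrite !inE /= => /andP[/andP[vF vW] /and3P[_ _ uv]].
apply: contra not1 => /eqP fvh.
(* A filled vertex outside the branch of [h] can only be the center. *)
have uc : u = c.
  apply/eqP/negPn/negP => uc; have := Fh u uF uc.
  by rewrite (branch_adj uv) // fvh eqxx.
rewrite uc in uW uv def_v *.
have vh : v = h by apply: branch_inj.
apply/cards1P; exists v; apply/setP => h'; rewrite !inE.
apply/andP/eqP => [[h'F h'W]|->]; last by move: hF; rewrite vh inE -vh.
have /untouchedP[ch' _] : h' \in untouched F by rewrite inE.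
apply/set1P; rewrite -def_v !inE /induced /= h'W uW ch' !andbT.
by rewrite untouched_unfilled // inE.
Qed.

Lemma force_seq_untouched W F F' :
  force_seq e W F F' -> #|untouched F :&: W| != 1 ->
  untouched F' = untouched F.
Proof.
elim=> {F F'} // F u v F' uv _ IH not1.
by have eqF := forces_untouched uv not1; rewrite IH eqF.
Qed.

(** If the whole selection [S] shows exactly one untouched vertex [h], the
    oracle leaves out the component containing [h].  Something remains to be
    answered because components are disjoint: [h] lies in only one of the at
    least two selected. *)
Lemma oracle_answer (F : {set T}) (S : {set {set T}}) :
    S \subset components e (~: F) -> 1 < #|S| ->
  exists O : {set {set T}},
    [/\ O \subset S, O != set0
      & #|untouched F :&: (F :|: cover O)| != 1].
Proof.
move=> subS S_gt1.
have sym : symmetric (induced e (~: F)).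
  by move=> x y; rewrite /induced /= e_sym andbCA.
have eqv : {in ~: F & &, equivalence_rel (connect (induced e (~: F)))}.
  move=> x y z _ _ _; split=> // xy.
  exact: (same_connect (sym_connect_sym sym) xy).
have /and3P[_ /trivIsetP tr _] := equivalence_partitionP eqv.
have [/eqP one|not1] := eqVneq #|untouched F :&: (F :|: cover S)| 1; last first.
  by exists S; rewrite -card_gt0 (ltnW S_gt1).
have /cards1P[h def_h] := one.
have hmem h' (X : {set T}) :
    h' \in untouched F -> X \in S -> h' \in X -> h' = h.
  move=> h'F XS h'X; apply/set1P; rewrite -def_h !inE in h'F *.
  by rewrite h'F; apply/orP; right; apply/bigcupP; exists X.
exists [set X in S | h \notin X]; split.
- by apply/subsetP => X; rewrite inE => /andP[].
- apply: contraTneq S_gt1 => noX.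
  have allh X : X \in S -> h \in X.
    move=> XS; apply/negPn/negP => hX; have : X \in set0 by rewrite -noX inE XS.
    by rewrite inE.
  rewrite -leqNgt; apply/card_le1_eqP => Y X YS XS.
  apply/eqP/negPn/negP => neXY.
  have := tr _ _ (subsetP subS _ XS) (subsetP subS _ YS) neXY.
  by move=> /disjoint_setI0/setP/(_ h); rewrite !inE !allh.
- rewrite (_ : _ :&: _ = set0) ?cards0 //; apply/setP => h'; rewrite [RHS]inE.
  apply/negP; rewrite inE => /andP[h'F].
  rewrite inE (negPf (untouched_unfilled h'F)) /=.
  move=> /bigcupP[X]; rewrite inE => /andP[XS hX] h'X.
  by rewrite -(hmem h' X) // h'X in hX.
Qed.

Lemma player_wins_untouched q n F :
  0 < q -> player_wins q e n F -> #|untouched F| <= n.+1.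
Proof.
move=> q_gt0; elim=> {n F}.
- move=> n; rewrite (_ : untouched _ = set0) ?cards0 //; apply/setP => h.
  by rewrite [RHS]inE; apply/negP => /untouched_unfilled; rewrite inE.
- by move=> n F v _ IH; apply: leq_trans (untouched_fill v F) _.
- move=> n F u v uv _ IH.
  have [->//|not1] := eqVneq #|untouched F| 1.
  by rewrite -(forces_untouched uv) // setIT.
- move=> n F S resp subS S_gtq respP _ IH.
  have [O [subO O0 not1]] := oracle_answer subS (leq_ltn_trans q_gt0 S_gtq).
  by rewrite -(force_seq_untouched (respP O subO O0)) // IH.
Qed.

End CutVertex.

(** * Moves that do not depend on the shape of the graph *)

(** Forcing needs a filled vertex, even after an answer of the oracle. *)
Lemma wins_no_token q (T : finType) (e : rel T) n (F : {set T}) :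
  T -> player_wins q e n F -> F = set0 -> 0 < n.
Proof.
move=> x0; elim=> {n F} //.
- by move=> n /setP/(_ x0); rewrite !inE.
- by move=> n F u v /andP[+ _] _ _ F0; rewrite F0 !inE.
move=> n F S resp _ S_gtq respP _ IH F0.
have S0 : S != set0 by rewrite -card_gt0 (leq_ltn_trans _ S_gtq).
apply: (IH S (subxx S) S0); have := respP S (subxx S) S0; rewrite F0.
move: (_ :|: _) (resp S) => W G.
suff noforce A : force_seq e W A G -> A = set0 -> G = set0 by move=> /noforce->.
by elim=> // {}A u v B /andP[+ _] _ _ A0; rewrite A0 !inE.
Qed.

(** The target [v] may already be filled; the move is then void.  This spares
    every forcing strategy a case distinction. *)
Lemma wins_force_or_skip q (T : finType) (e : rel T) n (F : {set T}) u v :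
    u \in F -> e u v -> (forall w, e u w -> w != v -> w \in F) ->
  player_wins q e n (v |: F) -> player_wins q e n F.
Proof.
move=> uF uv nbr; have [vF|vF] := boolP (v \in F).
  by rewrite (setUidPr _) // sub1set.
apply: wins_force (u) _ _; rewrite /forces !inE uF /=.
apply/eqP/setP => w; rewrite !inE /induced /= !inE /= andbT.
apply/andP/eqP => [[wF uw]|->] //.
by apply: contraNeq wF; apply: nbr.
Qed.

(** * Duplicate-free sequences *)

Lemma uniq_cat_inj (T : eqType) (x : T) s1 s2 t1 t2 :
    uniq (s1 ++ x :: s2) -> s1 ++ x :: s2 = t1 ++ x :: t2 ->
  s1 = t1 /\ s2 = t2.
Proof.
elim: s1 t1 => [|a s1 IH] [|b t1] //=.
- by move=> _ [].
- by move=> /andP[xs _] [xb es]; rewrite es mem_cat mem_head orbT in xs.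
- by move=> /andP[+ _] [ax _]; rewrite ax mem_cat mem_head orbT.
- by move=> /andP[_ us] [-> /(IH _ us)[-> ->]].
Qed.

Lemma uniq_flatten_inj (T : eqType) (ss : seq (seq T)) s t x :
  uniq (flatten ss) -> s \in ss -> t \in ss -> x \in s -> x \in t -> s = t.
Proof.
elim: ss => //= r ss IH; rewrite cat_uniq => /and3P[_ /hasPn out uss].
have notr s' : s' \in ss -> x \in s' -> x \notin r.
  by move=> s's xs'; apply: out; apply/flattenP; exists s'.
rewrite !inE => /predU1P[->|ss'] /predU1P[->|tss] // xs xt.
- by have := notr t tss xt; rewrite xs.
- by have := notr s ss' xs; rewrite xt.
- exact: IH.
Qed.

Lemma uniq_map_pick (T : eqType) (ss : seq (seq T)) (f : seq T -> T) :
  uniq (flatten ss) -> {in ss, forall s, f s \in s} -> uniq (map f ss).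
Proof.
elim: ss => //= s ss IH; rewrite cat_uniq => /and3P[_ /hasPn out uss] fP.
rewrite IH // ?andbT => [|t tss]; last by apply: fP; rewrite inE tss orbT.
apply/mapP => -[t tss est].
have /negP[] : f t \notin s.
  apply: out; apply/flattenP; exists t => //; apply: fP.
  by rewrite inE tss orbT.
by rewrite -est fP ?mem_head.
Qed.

(** * Adjacency and leaves in a spider *)

Section Spider.

Context (T : finType) (e : rel T) (c : T) (legs : seq (seq T)).
Hypothesis e_sym : symmetric e.
Hypothesis e_irr : irreflexive e.
Hypothesis legs_neq0 : all (fun p => p != [::]) legs.
Hypothesis legs_uniq : uniq (c :: flatten legs).
Hypothesis legs_cover : forall x, x \in c :: flatten legs.
Hypothesis legs_edges : forall x y, e x y =
  has (fun p => infix [:: x; y] (c :: p) || infix [:: y; x] (c :: p)) legs.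

Let flatten_uniq : uniq (flatten legs).
Proof. by have /andP[] := legs_uniq. Qed.

Lemma center_notin_leg p : p \in legs -> c \notin p.
Proof.
move=> pl; have /andP[+ _] := legs_uniq; apply: contra => cp.
by apply/flattenP; exists p.
Qed.

Lemma leg_uniq p : p \in legs -> uniq (c :: p).
Proof.
move=> pl /=; rewrite center_notin_leg //=.
move: flatten_uniq; elim: (legs) pl => //= r ss IH.
by rewrite cat_uniq inE => /predU1P[->|/IH {}IH] /and3P[].
Qed.

Lemma leg_inj p p' x :
  p \in legs -> p' \in legs -> x \in p -> x \in p' -> p = p'.
Proof. exact: uniq_flatten_inj. Qed.

Lemma in_leg x : x != c -> exists2 p : seq T, p \in legs & x \in p.
Proof.
by move=> xc; have := legs_cover x; rewrite inE (negPf xc) => /flattenP.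
Qed.

Lemma leg_adj s1 x s2 y : s1 ++ x :: s2 \in legs ->
  e x y = (y == last c s1) || (ohead s2 == Some y).
Proof.
move=> pl; rewrite legs_edges; have up := leg_uniq pl.
have xc : x != c.
  apply: contraNneq (center_notin_leg pl) => <-.
  by rewrite mem_cat mem_head orbT.
have same p' : p' \in legs -> x \in c :: p' -> p' = s1 ++ x :: s2.
  rewrite inE (negPf xc) => p'l xp'.
  by apply: leg_inj p'l pl xp' _; rewrite mem_cat mem_head orbT.
apply/hasP/orP => [[p' p'l /orP[]/infixP[t1 [t2 def]]]|[/eqP->|]].
- have xp' : x \in c :: p' by rewrite def !mem_cat mem_head orbT.
  rewrite (same p' p'l xp') in def; right.
  by have [_ ->] := @uniq_cat_inj _ x (c :: s1) s2 t1 (y :: t2) up def.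
- have xp' : x \in c :: p' by rewrite def !mem_cat !inE eqxx !orbT.
  rewrite (same p' p'l xp') in def; left.
  have [] := @uniq_cat_inj _ x (c :: s1) s2 (rcons t1 y) t2 up.
    by rewrite cat_rcons.
  by move=> /(congr1 (last c)) /=; rewrite last_rcons => ->.
- exists (s1 ++ x :: s2) => //; apply/orP; right; apply/infixP.
  exists (belast c s1), s2.
  by rewrite -(cat_rcons (last c s1)) -lastI.
- case: s2 pl {up same} => // z s2 pl /eqP[<-].
  exists (s1 ++ [:: x, z & s2]) => //; apply/orP; left; apply/infixP.
  by exists (c :: s1), s2.
Qed.

Lemma center_adj y : e c y = (y \in map (head c) legs).
Proof.
apply/idP/mapP => [cy|[p pl ->]].
  have yc : y != c by apply: contraTneq cy => ->; rewrite e_irr.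
  have [p pl yp] := in_leg yc; rewrite e_sym in cy.
  case/splitPr: yp pl => s1 s2 pl; exists (s1 ++ y :: s2) => //.
  have := leg_uniq pl; have := leg_adj c pl; rewrite cy => /esym/orP[/eqP|].
    by case: s1 {pl} => //= a s1 ->; rewrite -cat_cons mem_cat mem_last.
  case: s2 pl => //= z s2 pl /eqP[->].
  by rewrite mem_cat !inE eqxx !orbT.
have := allP legs_neq0 p pl; case: p pl => //= x s pl _.
by rewrite e_sym (@leg_adj [::] x s) //= eqxx.
Qed.

Lemma head_in_leg p : p \in legs -> head c p \in p.
Proof. by move=> /(allP legs_neq0); case: p => //= x s _; rewrite mem_head. Qed.

Lemma last_in_leg p : p \in legs -> last c p \in p.
Proof. by move=> /(allP legs_neq0); case: p => //= x s _; rewrite mem_last. Qed.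

Lemma card_center_nbrs : #|[set h | e c h]| = size legs.
Proof.
rewrite -(size_map (head c)) -(card_uniqP _); last first.
  by apply: uniq_map_pick => // p; apply: head_in_leg.
by apply: eq_card => h; rewrite inE center_adj.
Qed.

Lemma leaf_in_leg s1 x s2 : s1 ++ x :: s2 \in legs ->
  is_leaf e x = (s2 == [::]).
Proof.
move=> pl; rewrite /is_leaf; have := leg_uniq pl.
case: s2 pl => [|y s2] pl up.
  rewrite (_ : [set _ | _] = [set last c s1]) ?cards1 //.
  by apply/setP => w; rewrite !inE (leg_adj w pl) orbF.
rewrite (_ : [set _ | _] = [set last c s1; y]).
  rewrite cards2 (_ : _ != y) //; apply: contraTneq up => eqy.
  have := mem_last c s1; rewrite eqy -cat_cons cat_uniq => ys1.
  by rewrite /= ys1 orbT /= andbF.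
apply/setP => w; rewrite !inE (leg_adj w pl) /=; congr (_ || _).
by apply/eqP/eqP => [[]|->].
Qed.

Lemma card_leaves :
  #|[set x | is_leaf e x]| = size legs + (size legs == 1).
Proof.
(* The tips of the legs, and the center if it has degree one. *)
pose ends := map (last c) legs ++ nseq (size legs == 1) c.
have uends : uniq ends.
  rewrite cat_uniq uniq_map_pick // => [|p]; last exact: last_in_leg.
  rewrite (_ : uniq (nseq _ _)) ?andbT; last by case: (_ == _).
  apply/hasPn => x; rewrite mem_nseq => /andP[_ /eqP->].
  apply/mapP => -[p pl eqc].
  by have := center_notin_leg pl; rewrite {1}eqc last_in_leg.
have -> : size legs + (size legs == 1) = size ends.
  by rewrite size_cat size_map size_nseq.
rewrite -(card_uniqP uends); apply: eq_card => x; rewrite inE mem_cat mem_nseq.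
have [->|xc] := eqVneq x c.
  rewrite /is_leaf card_center_nbrs andbT lt0b.
  case: (_ == 1); rewrite ?orbT //.
  apply/esym/negP; rewrite orbF => /mapP[p pl eqc].
  by have := center_notin_leg pl; rewrite {1}eqc last_in_leg.
have [p pl xp] := in_leg xc; rewrite andbF orbF.
case/splitPr: xp pl => s1 s2 pl; rewrite (leaf_in_leg pl).
apply/eqP/mapP => [s20|[p' p'l eqx]].
  by exists (s1 ++ x :: s2); rewrite // last_cat s20.
have xp : x \in s1 ++ x :: s2 by rewrite mem_cat mem_head orbT.
have xp' : x \in p' by rewrite eqx last_in_leg.
have eqp := leg_inj p'l pl xp' xp.
have := leg_uniq pl; move: eqx; rewrite eqp last_cat /=.
case: s2 {pl xp eqp} => //= y s2 eqx; rewrite cat_uniq => /and3P[_ _].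
by rewrite eqx /= mem_last andbF.
Qed.

(** * The lower bound for a spider *)

(** The legs are the branches at the center, and all are untouched at the
    start. *)
Lemma wins_legs_le q n :
  0 < q -> player_wins q e n set0 -> size legs <= n.+1.
Proof.
move=> q_gt0 win; rewrite -card_center_nbrs.
(* The default leg [[::]] is only reached at the center. *)
pose leg_of x := nth [::] legs (find (fun p => x \in p) legs).
have leg_ofE p x : p \in legs -> x \in p -> leg_of x = p.
  move=> pl xp; have hx : has (fun p => x \in p) legs by apply/hasP; exists p.
  apply: leg_inj pl _ xp; first by rewrite mem_nth // -has_find.
  exact: (nth_find [::] hx).
have branch_adj x y : e x y -> x != c -> y != c -> leg_of x = leg_of y.
  move=> xy xc yc; have [p pl xp] := in_leg xc; rewrite (leg_ofE _ _ pl xp).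
  apply/esym/leg_ofE => //; case/splitPr: xp pl => s1 s2 pl.
  move: xy; rewrite (leg_adj y pl) mem_cat => /orP[/eqP eqy|].
    case: s1 eqy {pl} yc => [|a s1] /= -> ; first by rewrite eqxx.
    by rewrite mem_last.
  by case: s2 {pl} => //= z s2 /eqP[->]; rewrite !inE eqxx !orbT.
have branch_inj h h' : e c h -> e c h' -> leg_of h = leg_of h' -> h = h'.
  rewrite !center_adj => /mapP[p pl ->] /mapP[p' p'l ->].
  by rewrite (leg_ofE p) ?head_in_leg // (leg_ofE p') ?head_in_leg // => ->.
have := player_wins_untouched e_sym e_irr branch_adj branch_inj q_gt0 win.
apply: leq_trans; apply/subset_leq_card/subsetP => h; rewrite inE => ch.
by apply/untouchedP; split=> // x; rewrite inE.
Qed.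

(** * The strategy of the player *)

(** The outer part [t] of a leg forces the rest of the leg, from its tip side
    towards the center; the center itself is not part of the leg and is left
    to a later force. *)
Lemma wins_inward q n s t (F : {set T}) :
    s ++ t \in legs -> t != [::] -> {subset t <= F} ->
  player_wins q e n (F :|: [set x in s ++ t]) -> player_wins q e n F.
Proof.
elim/last_ind: s t F => [|s x IH] [//|y t] F pl _ tF win.
  rewrite (setUidPl _) // in win.
  by apply/subsetP => z; rewrite inE => /tF.
rewrite cat_rcons in pl win.
have adj w : e y w = (w == x) || (ohead t == Some w).
  by rewrite -(last_rcons c s x); apply: leg_adj; rewrite cat_rcons.
apply: (@wins_force_or_skip _ _ _ _ _ y x).
- by rewrite tF ?mem_head.
- by rewrite adj eqxx.
- move=> w; rewrite adj => /orP[->//|].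
  case: t {pl win adj} tF => //= z t tF /eqP[<-] _.
  by rewrite tF // !inE eqxx orbT.
apply: (IH (x :: y :: t)) => //.
  by move=> z; rewrite in_cons in_setU1 => /orP[->//|/tF->]; rewrite orbT.
rewrite -setUA (setUidPr _) // sub1set !inE mem_cat mem_head.
by rewrite !orbT.
Qed.

Lemma wins_fill_leg q n p (F : {set T}) : p \in legs ->
  player_wins q e n (F :|: [set x in p]) -> player_wins q e n.+1 F.
Proof.
case/lastP: p => [|s x] pl win; first by have := allP legs_neq0 _ pl.
rewrite -cats1 in pl win; apply: (@wins_fill _ _ _ _ _ x).
apply: (wins_inward pl) => // [z|]; first by rewrite !inE => ->.
rewrite -setUA (setUidPr _) // sub1set !inE mem_cat mem_head.
by rewrite !orbT.
Qed.

Lemma wins_fill_legs q n ls (F : {set T}) : {subset ls <= legs} ->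
  player_wins q e n (F :|: [set x in flatten ls]) ->
  player_wins q e (n + size ls) F.
Proof.
elim: ls F => [|p ls IH] F sub win.
  have nil0 : [set x in flatten [::]] = set0 :> {set T}.
    by apply/setP => x; rewrite !inE.
  by rewrite addn0; rewrite nil0 setU0 in win.
rewrite addnS; apply: (@wins_fill_leg _ _ p); first by rewrite sub ?mem_head.
apply: IH => [z zl|]; first by rewrite sub // inE zl orbT.
rewrite -setUA (_ : [set x in p] :|: _ = [set x in flatten (p :: ls)]) //.
by apply/setP => x; rewrite !inE mem_cat.
Qed.

(** Once everything but an outer part [t] of a leg is filled, the vertex
    just before [t] has at most the first vertex of [t] left to force.  With
    [s = [::]] this forcing vertex is the center. *)
Lemma wins_outward q n s t (F : {set T}) : s ++ t \in legs ->
    (forall x, x \notin t -> x \in F) ->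
  player_wins q e n F.
Proof.
elim: t s F => [|x t IH] s F pl outF.
  rewrite (_ : F = setT); first exact: wins_done.
  by apply/setP => x; rewrite inE outF.
have up := leg_uniq pl; rewrite -cat_cons cat_uniq in up.
have last_out : last c s \notin x :: t.
  have /and3P[_ /hasPn st _] := up.
  by apply: contraTN (mem_last c s) => /st.
apply: (@wins_force_or_skip _ _ _ _ _ (last c s) x).
- by apply: outF.
- by rewrite e_sym (leg_adj _ pl) eqxx.
- move=> w cw wx; apply: outF; apply: contra last_out.
  rewrite inE (negPf wx) /= => wt; case/splitPr: wt pl => a b pl.
  rewrite e_sym (@leg_adj (s ++ x :: a) w b) -?catA // in cw.
  move: cw; rewrite last_cat /= -cat_cons mem_cat => /orP[/eqP->|].
    by rewrite mem_last.
  by case: b {pl} => //= z b /eqP[->]; rewrite !inE eqxx !orbT.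
apply: (IH (rcons s x)); first by rewrite cat_rcons.
move=> z zt; rewrite !inE; case: eqVneq => //= zx.
by apply: outF; rewrite inE negb_or zx.
Qed.

Lemma wins_spider q : legs != [::] ->
  player_wins q e (size legs + (size legs == 1) - 1) set0.
Proof.
case def: legs => [//|p [|p' ls]] _ /=.
  have pl : p \in legs by rewrite def mem_head.
  apply: (@wins_fill _ _ _ _ _ c); apply: (@wins_outward _ _ [::] p) => // x xp.
  by have := legs_cover x; rewrite def /= cats0 !inE (negPf xp) !orbF.
have [pl p'l] : p \in legs /\ p' \in legs by rewrite def !inE !eqxx !orbT.
(* All legs but [p] are paid for; the head [y] of [p'] then forces the
   center. *)
rewrite addn0 subn1 /= -[_.+1]add0n.
apply: (@wins_fill_legs _ _ (p' :: ls)).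
  by move=> z zl; rewrite def inE zl orbT.
rewrite set0U; case: p' => [|y s] in def p'l *.
  by have := allP legs_neq0 _ p'l.
have adj w : e y w = (w == c) || (ohead s == Some w).
  exact: (@leg_adj [::]).
apply: (@wins_force_or_skip _ _ _ _ _ y c).
- by rewrite inE mem_head.
- by rewrite adj eqxx.
- move=> w; rewrite adj => /orP[->//|].
  by case: (s) => //= z s' /eqP[<-] _; rewrite !inE eqxx orbT.
apply: (@wins_outward _ _ [::] p) => // x xp.
have := legs_cover x; rewrite def !inE /= mem_cat (negPf xp) /=.
by rewrite !inE.
Qed.

End Spider.

Theorem mainTheorem3 (q : nat) (hq : 1 <= q) (T : finType) (e : rel T)
  (e_sym : symmetric e) (e_irr : irreflexive e)
  (H_star : generalized_star e) (k : nat)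
  (k_leaves : #|[set x | is_leaf e x]| = k) :
  Zq q e = k - 1.
Proof.
case: H_star => c [legs [legs0 legs_neq0 legs_uniq cov edges]].
rewrite -k_leaves (card_leaves e_sym e_irr legs_neq0 legs_uniq cov edges).
rewrite /Zq; case: ex_minnP => n /asboolP win min_n.
have le_n := wins_legs_le e_sym e_irr legs_neq0 legs_uniq cov edges hq win.
have n_gt0 := wins_no_token c win erefl.
apply/eqP; rewrite eqn_leq; apply/andP; split; last first.
  by rewrite leq_subLR add1n; case: eqP le_n => [->|] _; rewrite ?addn0.
apply: min_n; apply/asboolP.
exact: (wins_spider e_sym legs_neq0 legs_uniq cov edges q legs0).
Qed.
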